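(* Let $\mathcal{H}$ be a real Hilbert space, let $A:\mathcal{H}\rightrightarrows\mathcal{H}$ be maximal monotone with $A^{-1}(0)\neq\emptyset$, let $\theta>0$, let $p\geq1$ be an integer, and let $(x,\lambda):[0,+\infty)\to\mathcal{H}\times(0,+\infty)$ be a global solution of \[ \dot{x}(t)+x(t)-(I+\lambda(t)A)^{-1}x(t)=0,\qquad \lambda(t)\,\|(I+\lambda(t)A)^{-1}x(t)-x(t)\|^{p-1}=\theta, \] with $x(0)\in\{x\in\mathcal{H}:0\notin Ax\}$. Suppose that either (i) $A=\nabla\Phi$ where $\Phi:\mathcal{H}\to\mathbb{R}\cup\{+\infty\}$ is convex, differentiable and inf-compact, or (ii) $A^{-1}(0)$ has nonempty interior. Then there exists $\bar{x}\in A^{-1}(0)$ such that $x(t)$ converges strongly to $\bar{x}$ as $t\to+\infty$.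
   Context: $(I+\lambda A)^{-1}$ is the resolvent of $A$ of index $\lambda>0$; $A^{-1}(0)=\{x:0\in Ax\}$. A function $\Phi$ is inf-compact if for every $r>0$ and $\kappa\in\mathbb{R}$ the set $\{x\in\mathcal{H}:\|x\|\leq r,\ \Phi(x)\leq\kappa\}$ is relatively compact in $\mathcal{H}$. *)

(* Defs.v *)
From HB Require Import structures.
From mathcomp Require Import all_boot all_order all_algebra.
From mathcomp Require Import all_classical all_reals all_analysis.
Set Implicit Arguments. Unset Strict Implicit. Unset Printing Implicit Defensive.
Import Order.TTheory GRing.Theory Num.Theory.
Import numFieldNormedType.Exports.
Local Open Scope classical_set_scope.
Local Open Scope ring_scope.

Definition is_inner_product (R : realType) (V : completeNormedModType R)
  (ip : V -> V -> R) : Prop :=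
  [/\ (forall x y, ip x y = ip y x),
      (forall a x y z, ip (a *: x + y) z = a * ip x z + ip y z)
    & (forall x, ip x x = `|x| ^+ 2)].

Definition monotone_op (R : realType) (V : completeNormedModType R)
  (ip : V -> V -> R) (A : V -> set V) : Prop :=
  forall x y u v, A x u -> A y v -> 0 <= ip (x - y) (u - v).

Definition maximal_monotone (R : realType) (V : completeNormedModType R)
  (ip : V -> V -> R) (A : V -> set V) : Prop :=
  monotone_op ip A /\
  forall x u, (forall y v, A y v -> 0 <= ip (x - y) (u - v)) -> A x u.

Definition zeros (R : realType) (V : completeNormedModType R)
  (A : V -> set V) : set V := [set x | A x 0].

(* Resolvent (I + lam A)^{-1} x: the point y with x ∈ y + lam A y
   (single-valued and everywhere defined for A maximal monotone, lam > 0). *)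
Definition resolvent (R : realType) (V : completeNormedModType R)
  (A : V -> set V) (lam : R) (x : V) : V :=
  get [set y | exists u, A y u /\ x = y + lam *: u].

Definition convex_fun (R : realType) (V : completeNormedModType R)
  (Phi : V -> R) : Prop :=
  forall x y (s : R), 0 <= s <= 1 ->
    Phi (s *: x + (1 - s) *: y) <= s * Phi x + (1 - s) * Phi y.

Definition inf_compact (R : realType) (V : completeNormedModType R)
  (Phi : V -> R) : Prop :=
  forall (r k : R), 0 < r ->
    compact (closure [set x : V | `|x| <= r /\ Phi x <= k]).

Definition is_gradient_of (R : realType) (V : completeNormedModType R)
  (ip : V -> V -> R) (Phi : V -> R) (A : V -> set V) : Prop :=
  forall x u, A x u <-> (forall h, 'd Phi x h = ip u h).

(* Main.v *)
(** Along the trajectory [x' = y - x], where [y t] is the resolvent point, and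
    [u t = - x' t / lam t] belongs to [A (y t)].  For every zero [z] of [A],
    monotonicity gives [d/dt |x - z|^2 <= - 2 |x'|^2].  Hence [|x - z|] is
    nonincreasing (Fejer monotonicity) and the mean value theorem on the
    intervals [n, n + 1] yields times [t_n] tending to infinity with
    [x' t_n --> 0]; since [|u| = |x'|^p / theta], also [u t_n --> 0], so by
    maximality every strong limit point of [x t_n] is a zero, and by Fejer
    monotonicity the whole trajectory converges to it.
    If [A] is the gradient of [Phi], then
    [Phi (y t) <= Phi z + |u t| * |y t - z|], so that inf-compactness provides
    the limit point.  If [A^-1(0)] contains a ball of radius [r] around [z],
    monotonicity gives [d/dt |x - z|^2 <= - 2 r |x'|]: [x] has finite length.
    That the resolvent is defined everywhere is Minty's theorem, obtained
    following Simons and Zalinescu by minimizing the Fitzpatrick function plus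
    half the squared norm. *)

Require Import Defs.
From HB Require Import structures.
From mathcomp Require Import all_boot all_order all_algebra.
From mathcomp Require Import all_classical all_reals all_analysis.
From mathcomp Require Import ring lra.
Import Order.TTheory GRing.Theory Num.Theory.
Import numFieldNormedType.Exports.
Local Open Scope classical_set_scope.
Local Open Scope ring_scope.

(** * Inner product calculus: Cauchy-Schwarz, continuity, product rule *)

Section InnerProduct.
Set Implicit Arguments.
Unset Strict Implicit.
Variables (R : realType) (V : completeNormedModType R) (ip : V -> V -> R).
Hypothesis ipP : is_inner_product ip.

Lemma ipC x y : ip x y = ip y x.
Proof. by case: ipP. Qed.

Lemma ipxx x : ip x x = `|x| ^+ 2.
Proof. by case: ipP. Qed.

Lemma ipDl x y z : ip (x + y) z = ip x z + ip y z.
Proof. by case: ipP => _ /(_ 1 x y z); rewrite scale1r mul1r. Qed.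

Lemma ip0l z : ip 0 z = 0.
Proof. by have := ipDl 0 0 z; rewrite addr0 => /eqP; rewrite -subr_eq subrr => /eqP. Qed.

Lemma ipZl a x z : ip (a *: x) z = a * ip x z.
Proof. by case: ipP => _ /(_ a x 0 z); rewrite ip0l !addr0. Qed.

Lemma ipNl x z : ip (- x) z = - ip x z.
Proof. by rewrite -scaleN1r ipZl mulN1r. Qed.

Lemma ipDr x y z : ip z (x + y) = ip z x + ip z y.
Proof. by rewrite !(ipC z) ipDl. Qed.

Lemma ipZr a x z : ip z (a *: x) = a * ip z x.
Proof. by rewrite !(ipC z) ipZl. Qed.

Lemma ipNr x z : ip z (- x) = - ip z x.
Proof. by rewrite !(ipC z) ipNl. Qed.

Lemma ip0r z : ip z 0 = 0.
Proof. by rewrite ipC ip0l. Qed.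

Definition ipE := (ipDl, ipDr, ipNl, ipNr, ipZl, ipZr).

(** Reduces the continuity of [ip] to that of the norm. *)
Lemma ip_polarization x y : ip x y = (`|x + y| ^+ 2 - `|x - y| ^+ 2) / 4.
Proof. by rewrite -!ipxx !ipE (ipC y x); field. Qed.

Lemma ip_le_norm x y : ip x y <= `|x| * `|y|.
Proof.
(* This square expands to [2 * |x| * |y| * (|x| * |y| - ip x y)]. *)
have := sqr_ge0 `| `|y| *: x - `|x| *: y|.
rewrite -ipxx !ipE !ipxx (ipC y x) => h.
have [->|x0] := eqVneq x 0; first by rewrite ip0l normr0 mul0r.
have [->|y0] := eqVneq y 0; first by rewrite ip0r normr0 mulr0.
have xy0 : 0 < `|x| * `|y| by rewrite mulr_gt0 ?normr_gt0.
rewrite -(ler_pM2l xy0); nra.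
Qed.

Lemma cvg_norm2 (T : Type) (F : set_system T) {FF : Filter F} (f : T -> V) a :
  f @ F --> a -> `|f t| ^+ 2 @[t --> F] --> `|a| ^+ 2.
Proof. by move=> fa; exact: (cvgM (cvg_norm fa) (cvg_norm fa)). Qed.

Lemma cvg_ip (T : Type) (F : set_system T) {FF : Filter F} (f g : T -> V) a b :
  f @ F --> a -> g @ F --> b -> ip (f t) (g t) @[t --> F] --> ip a b.
Proof.
move=> fa gb; rewrite ip_polarization.
under eq_fun do rewrite ip_polarization.
apply: cvgM; last exact: cvg_cst.
by apply: cvgB; apply: cvg_norm2; [apply: cvgD | apply: cvgB].
Qed.

Lemma is_derive_ip (f g : R -> V) (df dg : V) (t : R) :
  is_derive t 1 f df -> is_derive t 1 g dg ->
  is_derive t 1 (fun s => ip (f s) (g s)) (ip df (g t) + ip (f t) dg).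
Proof.
move=> [fd <-] [gd <-].
(* The difference quotient is split with [g] taken at the shifted time, whence the need for its
   continuity. *)
have cg : (fun h : R => g (h *: 1 + t)) @ 0^' --> g t.
  have /differentiable_continuous cg : differentiable g t by exact/derivable1_diffP.
  apply: (@cvg_comp _ _ _ (fun h : R => h *: 1 + t) g _ (nbhs t)) => //.
  under eq_fun do rewrite /GRing.scale /= mulr1.
  have : h + t @[h --> (0 : R)] --> 0 + t by apply: cvgD; [exact: cvg_id | exact: cvg_cst].
  by rewrite add0r; exact: cvg_within_filter.
have M := cvgD (cvg_ip fd cg) (cvg_ip (cvg_cst (f t)) gd).
have L : h^-1 *: (((fun s => ip (f s) (g s)) \o shift t) (h *: 1) - ip (f t) (g t))
    @[h --> 0^'] --> ip ('D_1 f t) (g t) + ip (f t) ('D_1 g t).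
  rewrite (_ : (fun h => _) = fun h => ip (h^-1 *: ((f \o shift t) (h *: 1) - f t)) (g (h *: 1 + t))
     + ip (f t) (h^-1 *: ((g \o shift t) (h *: 1) - g t))); first exact: M.
  by apply/funext => h /=; rewrite !ipE /GRing.scale /=; ring.
by split; [apply: cvgP L | apply: cvg_lim L].
Qed.

End InnerProduct.

(** * Minty's theorem through the Fitzpatrick function *)

Section Minty.
Set Implicit Arguments.
Unset Strict Implicit.
Variables (R : realType) (V : completeNormedModType R) (ip : V -> V -> R).
Hypothesis ipP : is_inner_product ip.

Lemma cauchy_norm_cvg (T : Type) (F : set_system T) {FF : ProperFilter F} (f : T -> V) :
  (forall e, 0 < e -> exists l, \forall t \near F, `|l - f t| < e) -> cvg (f @ F).
Proof.
move=> h; apply/cauchy_cvgP/cauchy_exP => e /h [l hl]; exists l.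
by near=> t; rewrite -ball_normE /=; near: t.
Unshelve. all: by end_near. Qed.

(** Plays the part of letting [s] tend to 0: if [a < 0], then [s = - a / (b - a)] gives the negative
    value [- a ^+ 2 / (b - a)]. *)
Lemma affine_ge0_origin (a b : R) : 0 <= b ->
  (forall s, 0 < s <= 1 -> 0 <= a + s * b) -> 0 <= a.
Proof.
move=> b0 h; rewrite leNgt; apply/negP => a0.
have ba : 0 < b - a by lra.
have /h : 0 < - a / (b - a) <= 1.
  by rewrite divr_gt0 ?oppr_gt0//= ler_pdivrMr//; lra.
rewrite (_ : a + _ = - (a ^+ 2 / (b - a))); last by field; lra.
by rewrite oppr_ge0 leNgt divr_gt0// exprn_even_gt0//= lt_eqF.
Qed.

Variable B : V -> set V.
Hypothesis maxB : maximal_monotone ip B.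

(* Epigraph of the Fitzpatrick function of [B]. *)
Let epi (w : V * V * R) : Prop :=
  forall y v, B y v -> ip w.1.1 v + ip y w.1.2 - ip y v <= w.2.

(** Twice the functional to be minimized, with a free height [w.2] in place of the Fitzpatrick
    value, so that no supremum has to be formed. *)
Let energy (w : V * V * R) : R := 2 * w.2 + `|w.1.1| ^+ 2 + `|w.1.2| ^+ 2.

Lemma epi_graph y v : B y v -> epi (y, v, ip y v).
Proof.
move=> Byv z w Bzw /=; have := maxB.1 _ _ _ _ Byv Bzw.
by rewrite !(ipE ipP); lra.
Qed.

(** Otherwise maximality would put the pair in the graph, and testing the epigraph condition on that
    very pair gives the inequality. *)
Lemma epi_ip w : epi w -> ip w.1.1 w.1.2 <= w.2.
Proof.
move=> Ew; rewrite leNgt; apply/negP => wlt.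
suff /Ew : B w.1.1 w.1.2 by lra.
by apply: maxB.2 => y v /Ew; rewrite !(ipE ipP); lra.
Qed.

Lemma energy_ge w : epi w -> `|w.1.1 + w.1.2| ^+ 2 <= energy w.
Proof. by move=> /epi_ip; rewrite /energy -!(ipxx ipP) !(ipE ipP) (ipC ipP w.1.2); lra. Qed.

Let seg (s : R) (a b : V * V * R) : V * V * R :=
  ((1 - s) *: a.1.1 + s *: b.1.1, (1 - s) *: a.1.2 + s *: b.1.2, (1 - s) * a.2 + s * b.2).

Lemma epi_seg s a b : 0 <= s <= 1 -> epi a -> epi b -> epi (seg s a b).
Proof.
move=> /andP[s0 s1] Ea Eb y v Byv; have := Ea _ _ Byv; have := Eb _ _ Byv.
by rewrite /= !(ipE ipP); nra.
Qed.

(** Strong convexity with its exact defect: midpoints make minimizing sequences Cauchy, and small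
    [s] gives first-order optimality. *)
Lemma energy_seg s a b : energy (seg s a b) = (1 - s) * energy a + s * energy b
  - s * (1 - s) * (`|a.1.1 - b.1.1| ^+ 2 + `|a.1.2 - b.1.2| ^+ 2).
Proof.
rewrite /energy /= -!(ipxx ipP) !(ipE ipP).
by rewrite (ipC ipP b.1.1 a.1.1) (ipC ipP b.1.2 a.1.2); ring.
Qed.

Lemma exists_energy_min : exists2 w, epi w & forall w', epi w' -> energy w <= energy w'.
Proof.
(* With an empty graph, maximality would vacuously put [(0, 0)] in it. *)
have [y [v Byv]] : exists y v, B y v.
  have [//|nB] := pselect (exists y v, B y v).
  by exists 0, 0; apply: maxB.2 => y v Byv; case: nB; exists y, v.
pose m := inf (energy @` epi).
have lbJ : has_lbound (energy @` epi).
  by exists 0 => _ [w Ew <-]; apply: le_trans (energy_ge Ew); exact: sqr_ge0.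
have infJ : has_inf (energy @` epi).
  by split=> //; exists (energy (y, v, ip y v)), (y, v, ip y v) => //; exact: epi_graph.
have energy_lb w : epi w -> m <= energy w by move=> Ew; apply: ge_inf => //; exists w.
have /choice[w wP] : forall n, exists w, epi w /\ energy w < m + n.+1%:R^-1.
  move=> n; have n0 : 0 < n.+1%:R^-1 :> R by rewrite invr_gt0.
  by have [_ [w Ew <-] Jw] := inf_adherent n0 infJ; exists w.
(* The midpoint of [w i] and [w j] has energy at least [m], which bounds the defect. *)
have dist i j : `|(w i).1.1 - (w j).1.1| ^+ 2 + `|(w i).1.2 - (w j).1.2| ^+ 2
    <= 2 * i.+1%:R^-1 + 2 * j.+1%:R^-1.
  have half : 0 <= (2^-1 : R) <= 1 by lra.
  have := energy_lb _ (epi_seg half (wP i).1 (wP j).1); rewrite energy_seg.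
  have := (wP i).2; have := (wP j).2; set q := _ ^+ 2 + _ ^+ 2.
  move: (energy (w i)) (energy (w j)) (i.+1%:R^-1) (j.+1%:R^-1) q => a b c d q; lra.
have cvgw (c : nat -> V) : (forall i j, `|c i - c j| ^+ 2 <= 2 * i.+1%:R^-1 + 2 * j.+1%:R^-1) ->
    cvg (c @ \oo).
  move=> hc; apply: cauchy_norm_cvg => e e0.
  have e4 : 0 < e ^+ 2 / 4 by rewrite divr_gt0 ?exprn_gt0.
  have [N hN] := filter_ex (near_infty_natSinv_lt (PosNum e4)).
  exists (c N); near=> t.
  have ht : t.+1%:R^-1 < e ^+ 2 / 4 by near: t; exact: near_infty_natSinv_lt (PosNum e4).
  rewrite -(ltr_pXn2r (_ : 0 < 2)%N) ?nnegrE ?(ltW e0)//.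
  apply: le_lt_trans (hc _ _) _; move: hN ht => /=.
  by move: (N.+1%:R^-1) (t.+1%:R^-1) (e ^+ 2) => a b d; lra.
have cx : cvg ((w n).1.1 @[n --> \oo]).
  by apply: cvgw => i j; apply: le_trans (dist i j); rewrite lerDl sqr_ge0.
have cu : cvg ((w n).1.2 @[n --> \oo]).
  by apply: cvgw => i j; apply: le_trans (dist i j); rewrite lerDr sqr_ge0.
have cJ : energy (w n) @[n --> \oo] --> m.
  apply: (@squeeze_cvgr _ _ _ _ (fun=> m) (fun n => m + n.+1%:R^-1)).
  - by apply: nearW => n; rewrite energy_lb ?(ltW (wP n).2)//; exact: (wP n).1.
  - exact: cvg_cst.
  - have : m + harmonic n @[n --> \oo] --> m + 0.
      by apply: cvgD; [exact: cvg_cst | exact: cvg_harmonic].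
    by rewrite addr0.
pose x0 := lim ((w n).1.1 @[n --> \oo]); pose u0 := lim ((w n).1.2 @[n --> \oo]).
(* The heights converge because the energies and both norms do; [k0] solves
   [energy (x0, u0, k0) = m]. *)
pose k0 := (m - `|x0| ^+ 2 - `|u0| ^+ 2) / 2.
have ck : (w n).2 @[n --> \oo] --> k0.
  rewrite (_ : (fun n => _) = fun n =>
    (energy (w n) - `|(w n).1.1| ^+ 2 - `|(w n).1.2| ^+ 2) / 2); last first.
    by apply/funext => n; rewrite /energy; field.
  apply: cvgM; last exact: cvg_cst.
  by apply: cvgB; [apply: cvgB => // |]; apply: cvg_norm2.
exists (x0, u0, k0); last first.
  move=> w' /energy_lb; apply: le_trans; rewrite /energy /k0 /=.
  by rewrite le_eqVlt; apply/orP; left; apply/eqP; field.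
move=> z t Bzt /=; apply: ler_cvg_to ck _; last first.
  by apply: nearW => n; apply: (wP n).1 Bzt.
apply: cvgB; last exact: cvg_cst.
by apply: cvgD; apply: cvg_ip => //; exact: cvg_cst.
Unshelve. all: by end_near. Qed.

(* First-order optimality of the minimizer [(x0, u0, k0)], tested on segments
   towards graph points, is [key]; it forces [(- u0, - x0)] into the graph, and
   [key] at that point itself gives [u0 = - x0]. *)
Lemma minty : exists x, B x (- x).
Proof.
have [[[x0 u0] k0] Ew minw] := exists_energy_min.
have key y v : B y v -> `|x0 + u0| ^+ 2 <= ip (y + u0) (v + x0).
  move=> Byv; have k0_ge := epi_ip Ew.
  pose d := `|x0 - y| ^+ 2 + `|u0 - v| ^+ 2.
  have : 0 <= energy (y, v, ip y v) - energy (x0, u0, k0) - d.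
    (* Minimality along the segment, divided by [s], leaves the defect [(1 - s) * d], affine in
       [s]. *)
    apply: (@affine_ge0_origin _ d); first by rewrite addr_ge0 ?sqr_ge0.
    move=> s /andP[s0 s1].
    have /minw : epi (seg s (x0, u0, k0) (y, v, ip y v)).
      by apply: epi_seg (epi_graph Byv) => //; rewrite (ltW s0).
    rewrite energy_seg /= -/d; move: (energy _) (energy _) d => a b d h.
    by rewrite -(pmulr_rge0 _ s0); lra.
  move: k0_ge; rewrite /d /energy /= -!(ipxx ipP) !(ipE ipP).
  rewrite !(ipC ipP y) !(ipC ipP v) !(ipC ipP u0 x0).
  by lra.
have Bw : B (- u0) (- x0).
  apply: maxB.2 => y v /key; rewrite !(ipE ipP) => h.
  by have := sqr_ge0 `|x0 + u0|; lra.
have := key _ _ Bw; rewrite addNr (ip0l ipP) => h.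
have /eqP : `|x0 + u0| == 0 by rewrite -sqrf_eq0 eq_le h sqr_ge0.
by move=> /normr0_eq0/eqP; rewrite addr_eq0 => /eqP x0E; exists (- u0); rewrite -x0E in Bw *.
Qed.

End Minty.

(** * Resolvents, limits in the graph, and the gradient inequality *)

Section MaximalMonotone.
Set Implicit Arguments.
Unset Strict Implicit.
Variables (R : realType) (V : completeNormedModType R) (ip : V -> V -> R).
Hypothesis ipP : is_inner_product ip.
Variable A : V -> set V.
Hypothesis maxA : maximal_monotone ip A.

(* Minty's theorem applied to [y |-> lam A y - x]. *)
Lemma resolvent_graph (lam : R) (x : V) : 0 < lam ->
  A (resolvent A lam x) (lam^-1 *: (x - resolvent A lam x)).
Proof.
move=> lam0; have lamN0 : lam != 0 by rewrite gt_eqF.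
have maxB : maximal_monotone ip (fun y => [set w | A y (lam^-1 *: (w + x))]).
  split=> [y1 y2 w1 w2 h1 h2|y w h].
    have := maxA.1 _ _ _ _ h1 h2; rewrite -scalerBr ipZr// pmulr_rge0 ?invr_gt0//.
    by rewrite opprD addrACA subrr addr0.
  apply: maxA.2 => y' v Av.
  have /h : A y' (lam^-1 *: ((lam *: v - x) + x)) by rewrite subrK scalerK.
  rewrite -(pmulr_rge0 _ (_ : 0 < lam^-1)) ?invr_gt0// -ipZr//.
  by rewrite opprB addrA scalerBr scalerK.
have [y Ay] := minty ipP maxB.
have [|u [Au xE]] := @getPex V [set y | exists u, A y u /\ x = y + lam *: u].
  exists y, (lam^-1 *: (- y + x)); split => //.
  by rewrite scalerKV// addrC addrAC addNr add0r.
rewrite -/(resolvent A lam x) in Au xE.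
by rewrite {2}xE addrC addKr scalerK.
Qed.

(** The monotonicity inequality against each graph point passes to the limit, and maximality
    concludes. *)
Lemma zeros_limit (T : topologicalType) (F : set_system T) {FF : ProperFilter F}
    (y u : T -> V) (l : V) :
  (forall t, A (y t) (u t)) -> y @ F --> l -> u @ F --> 0 -> zeros A l.
Proof.
move=> Ayu yl u0; apply: maxA.2 => z v Azv.
apply: (@ler_cvg_to _ F _ _ (fun=> 0) (fun t => ip (y t - z) (u t - v))).
- exact: cvg_cst.
- by apply: cvg_ip => //; apply: cvgB => //; exact: cvg_cst.
- by apply: nearW => t; apply: maxA.1.
Qed.

(** By convexity the difference quotients from [y] towards [z] are at most [Phi z - Phi y]; their
    right limit at 0 is [ip u (z - y)]. *)
Lemma gradient_le (Phi : V -> R) y u z :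
  convex_fun Phi -> differentiable Phi y -> is_gradient_of ip Phi A -> A y u ->
  Phi y + ip u (z - y) <= Phi z.
Proof.
move=> cPhi dPhi gradPhi /gradPhi/(_ (z - y)) <-.
rewrite -lerBrDl -deriveE//.
have /cvg_dnbhs_at_right L := diff_derivable (v := z - y) dPhi.
apply: (ler_cvg_to L (cvg_cst (Phi z - Phi y))).
near=> s; rewrite /= /GRing.scale /=.
have s0 : 0 < s by near: s; exact: nbhs_right_gt.
have s1 : s <= 1 by near: s; exact: nbhs_right_ltW.
rewrite mulrC ler_pdivrMr//.
have /(cPhi z y) : 0 <= s <= 1 by rewrite ltW.
rewrite (_ : s *: z + _ = s *: (z - y) + y); first by lra.
by rewrite scalerBl scale1r scalerBr addrAC addrA.
Unshelve. all: by end_near. Qed.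

End MaximalMonotone.

(** Stated for positive times only, where the trajectory is known to be differentiable. *)
Lemma MVT_pos (R : realType) (f df : R -> R) (a b : R) :
  (forall t : R, 0 < t -> is_derive t 1 f (df t)) -> 0 < a -> a < b ->
  exists2 c, a < c < b & f b - f a = df c * (b - a).
Proof.
move=> fd a0 ab.
have fd' t : t \in `]a, b[ -> is_derive t 1 f (df t).
  by rewrite in_itv /= => /andP[t0 _]; apply: fd; exact: lt_trans t0.
have fc : {within `[a, b], continuous f}.
  apply: derivable_within_continuous => t; rewrite in_itv /= => /andP[t0 _].
  by have [] := fd t (lt_le_trans a0 t0).
by have [c] := MVT ab fd' fc; rewrite in_itv; exists c.
Qed.

(** * Estimates along the trajectory and its convergence *)

Section Dynamics.
Set Implicit Arguments.
Unset Strict Implicit.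
Variables (R : realType) (V : completeNormedModType R) (ip : V -> V -> R).
Hypothesis ipP : is_inner_product ip.
Variable A : V -> set V.
Hypothesis maxA : maximal_monotone ip A.
Variables (theta : R) (p : nat) (x : R -> V) (lam : R -> R).
Hypothesis p_gt0 : (1 <= p)%N.
Hypothesis lam_gt0 : forall t : R, 0 <= t -> 0 < lam t.
Hypothesis x_derivable : forall t : R, 0 < t -> derivable x t 1.
Hypothesis x_ode : forall t : R, 0 < t -> 'D_1 x t + x t - resolvent A (lam t) (x t) = 0.
Hypothesis lam_law : forall t : R, 0 <= t ->
  lam t * `|resolvent A (lam t) (x t) - x t| ^+ (p - 1) = theta.

Let dx (t : R) : V := 'D_1 x t.
Let y t := x t + dx t.
Let u t := - ((lam t)^-1 *: dx t).

Lemma resolvent_trajectory (t : R) : 0 < t -> resolvent A (lam t) (x t) = y t.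
Proof. by move=> /x_ode/eqP; rewrite subr_eq0 addrC => /eqP. Qed.

Lemma trajectory_graph (t : R) : 0 < t -> A (y t) (u t).
Proof.
move=> t0; have := resolvent_graph ipP maxA (x t) (lam_gt0 (ltW t0)).
by rewrite resolvent_trajectory// /y opprD addNKr scalerN.
Qed.

(** The algebraic law eliminates [lam], so [u] is small as soon as the velocity is, with no lower
    bound on [lam]. *)
Lemma norm_trajectory_graph (t : R) : 0 < t -> `|u t| = `|dx t| ^+ p / theta.
Proof.
move=> t0; have l0 := lam_gt0 (ltW t0); have := lam_law (ltW t0).
rewrite resolvent_trajectory// /y [_ - _]addrC addKr => <-.
rewrite /u normrN normrZ ger0_norm ?invr_ge0 ?(ltW l0)//.
rewrite -{1}(subnK p_gt0) addn1 exprS invfM.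
(* [theta] now reads [lam t * |dx t| ^+ (p - 1)], which cancels only for nonzero velocity; otherwise
   both sides vanish. *)
have [d0|d0] := eqVneq (`|dx t|) 0; first by rewrite d0 !mul0r mulr0.
by field; rewrite expf_neq0//= gt_eqF.
Qed.

(** Monotonicity between [(y t, u t)] and [(z + w, 0)]. The shift [w] is 0 for Fejer monotonicity
    and ranges over a ball in the interior case. *)
Lemma ip_derive_le z w (t : R) : 0 < t -> zeros A (z + w) ->
  ip (dx t) (x t - z) <= ip (dx t) w - `|dx t| ^+ 2.
Proof.
move=> t0; have l0 := lam_gt0 (ltW t0); move=> /(maxA.1 _ _ _ _ (trajectory_graph t0)).
rewrite subr0 /u /y ipNr// ipZr// oppr_ge0 pmulr_rle0 ?invr_gt0//.
by rewrite -(ipxx ipP) !(ipE ipP) (ipC ipP (x t)) (ipC ipP z) (ipC ipP w); lra.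
Qed.

Let sqdist (z : V) (t : R) : R := `|x t - z| ^+ 2.

Lemma derive_sqdist z (t : R) : 0 < t -> is_derive t 1 (sqdist z) (2 * ip (dx t) (x t - z)).
Proof.
move=> t0; have xd : is_derive t 1 x (dx t) by split => //; exact: x_derivable.
have xzd : is_derive t 1 (fun s => x s - z) (dx t).
  by apply: is_derive_eq (is_deriveB xd (is_derive_cst z t 1)) _; rewrite subr0.
rewrite (_ : sqdist z = fun s => ip (x s - z) (x s - z)); last first.
  by apply/funext => s; rewrite ipxx.
apply: is_derive_eq (is_derive_ip ipP xzd xzd) _.
by rewrite (ipC ipP (x t - z)); ring.
Qed.

Lemma sqdist_drop z (a b : R) : zeros A z -> 0 < a -> a < b ->
  exists2 c, a < c < b & 2 * `|dx c| ^+ 2 * (b - a) <= sqdist z a - sqdist z b.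
Proof.
move=> Az a0 ab; have [c cab E] := MVT_pos (derive_sqdist z) a0 ab.
exists c => //; rewrite -lerN2 opprB E -mulNr ler_pM2r ?subr_gt0//.
have c0 : 0 < c by case/andP: cab => + _; exact: lt_trans.
have := @ip_derive_le z 0 c c0; rewrite addr0 (ip0r ipP) => /(_ Az).
by rewrite sub0r; lra.
Qed.

Lemma fejer z (a b : R) : zeros A z -> 0 < a -> a <= b -> `|x b - z| <= `|x a - z|.
Proof.
move=> Az a0; rewrite le_eqVlt => /predU1P[->//|ab].
rewrite -(ler_pXn2r (_ : 0 < 2)%N) ?nnegrE//.
have [c _ h] := sqdist_drop Az a0 ab; rewrite -subr_ge0; apply: le_trans h.
by rewrite !mulr_ge0 ?subr_ge0 ?(ltW ab).
Qed.

Lemma exists_slow_times : zeros A !=set0 -> exists c : nat -> R,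
  (forall n, n.+1%:R < c n) /\ dx (c n) @[n --> \oo] --> 0.
Proof.
move=> [z Az].
(* The intervals start at 1, since the velocity is controlled only at positive times. *)
have /choice[c cP] : forall n, exists c, n.+1%:R < c /\
    2 * `|dx c| ^+ 2 <= sqdist z n.+1%:R - sqdist z n.+2%:R.
  move=> n; have [||c /andP[nc _] h] := @sqdist_drop z n.+1%:R n.+2%:R Az.
  - by rewrite ltr0n.
  - by rewrite ltr_nat.
  - by exists c; split => //; move: h; rewrite -natrB// subSnn mulr1.
exists c; split; first by move=> n; have [] := cP n.
pose s n := sqdist z n.+1%:R.
have cs : cvg (s @ \oo).
  apply: nonincreasing_is_cvgn.
    by move=> i j ij; rewrite lerXn2r ?nnegrE// fejer ?ltr0n// ler_nat.
  by exists 0 => _ [n _ <-]; exact: sqr_ge0.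
have ds : s n - s n.+1 @[n --> \oo] --> 0.
  rewrite -(subrr (lim (s @ \oo))); apply: cvgB => //.
  by have := cs; rewrite -(cvg_shiftS s).
apply/cvgr0Pnorm_lt => e e0.
have e2 : 0 < e ^+ 2 by rewrite exprn_gt0.
near=> n; rewrite -(ltr_pXn2r (_ : 0 < 2)%N) ?nnegrE ?(ltW e0)//.
have : `|s n - s n.+1| < e ^+ 2 by near: n; exact: cvgr0_norm_lt.
move/(le_lt_trans (ler_norm _)); have := (cP n).2; rewrite -/(s n) -/(s n.+1).
have := sqr_ge0 `|dx (c n)|; move: (`|_| ^+ 2) (e ^+ 2) => a b.
by lra.
Unshelve. all: by end_near. Qed.

Lemma u_cvg0 (tau : nat -> R) : (forall n, 0 < tau n) ->
  dx (tau n) @[n --> \oo] --> 0 -> u (tau n) @[n --> \oo] --> 0.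
Proof.
move=> tau0 d0; apply/norm_cvg0P; under eq_fun do rewrite norm_trajectory_graph//.
have : `|dx (tau n)| ^+ p @[n --> \oo] --> (0 : R) ^+ p.
  apply: (continuous_cvg _ (@exprn_continuous R p 0)).
  by apply/norm_cvg0P.
(* Here [1 <= p] matters: [0 ^+ 0] would be 1. *)
rewrite expr0n eqn0Ngt p_gt0 mulr0n => h.
rewrite -(mul0r theta^-1); exact: cvgM h (cvg_cst _).
Qed.

(** Vanishing velocity gives [y] the same limit as [x] along [tau], so [l] is a zero; being close to
    [l] at one time [tau n] then persists by [fejer]. *)
Lemma cvg_of_slow_times (tau : nat -> R) (l : V) : (forall n, 0 < tau n) ->
  dx (tau n) @[n --> \oo] --> 0 -> x (tau n) @[n --> \oo] --> l ->
  zeros A l /\ x t @[t --> +oo] --> l.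
Proof.
move=> tau0 d0 xl.
have Al : zeros A l.
  apply: (zeros_limit ipP maxA (fun n => trajectory_graph (tau0 n)) _ (u_cvg0 tau0 d0)).
  by rewrite -(addr0 l); apply: cvgD.
split=> //; apply/cvgrPdistC_lt => e e0.
have /cvgrPdistC_lt/(_ e e0)/filter_ex[n hn] := xl.
by near=> t; apply: le_lt_trans hn; apply: fejer.
Unshelve. all: by end_near. Qed.

Lemma trajectory_cvg_interior : (zeros A)° !=set0 ->
  exists2 l, zeros A l & x t @[t --> +oo] --> l.
Proof.
move=> [z /nbhs_ballP[r0 /= r0_gt0 ballA]].
(* Halving the radius fits a closed ball inside the open one, so that shifts of norm exactly [r] are
   allowed. *)
pose r := r0 / 2; have r_gt0 : 0 < r by rewrite divr_gt0.
have Aball w : `|w| <= r -> zeros A (z + w).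
  move=> wr; apply: ballA; rewrite -ball_normE /= opprD addNKr normrN.
  by apply: le_lt_trans wr _; rewrite /r; lra.
have Az : zeros A z by rewrite -(addr0 z); apply: Aball; rewrite normr0 ltW.
have slope (t : R) : 0 < t -> ip (dx t) (x t - z) <= - (r * `|dx t|).
  (* The shift of length [r] opposite to the velocity gives [ip (dx t) w = - (r * |dx t|)]. *)
  move=> t0; pose w := - ((r / `|dx t|) *: dx t).
  have [d0|d0] := eqVneq (dx t) 0; first by rewrite d0 (ip0l ipP) normr0 mulr0 oppr0.
  have n0 : 0 < `|dx t| by rewrite normr_gt0.
  have wr : `|w| <= r.
    by rewrite normrN normrZ normrM normfV normr_id divfK ?gt_eqF// gtr0_norm.
  apply: le_trans (ip_derive_le t0 (Aball _ wr)) _.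
  rewrite /w !(ipE ipP) (ipxx ipP) (_ : - _ = - (r * `|dx t|)); last by field; rewrite gt_eqF.
  by rewrite gerDl oppr_le0 sqr_ge0.
have x_osc (s t : R) : 0 < s -> s < t ->
    2 * r * `|x t - x s| <= sqdist z s - sqdist z t.
  move=> s0 st; set h := x t - x s.
  have [h0|h0] := eqVneq h 0.
    by rewrite h0 normr0 mulr0 subr_ge0 lerXn2r ?nnegrE// fejer// ltW.
  have n0 : 0 < `|h| by rewrite normr_gt0.
  (* Replaces an integral of the speed: by [slope] and Cauchy-Schwarz [g] has nonpositive
     derivative, and [g t <= g s] is the claim multiplied by [|h|]. *)
  pose g (v : R) := 2 * r * ip (x v) h + `|h| * sqdist z v.
  pose dg (v : R) := 2 * r * ip (dx v) h + `|h| * (2 * ip (dx v) (x v - z)).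
  have gd (v : R) : 0 < v -> is_derive v 1 g (dg v).
    move=> v0; have xd : is_derive v 1 x (dx v) by split => //; exact: x_derivable.
    apply: is_deriveD; apply: is_deriveZ; last exact: derive_sqdist.
    apply: is_derive_eq (is_derive_ip ipP xd (is_derive_cst h v 1)) _.
    by rewrite (ip0r ipP) addr0.
  have [c /andP[sc _] E] := MVT_pos gd s0 st.
  have c0 : 0 < c by exact: lt_trans sc.
  have : g t - g s <= 0.
    rewrite E pmulr_lle0 ?subr_gt0// /dg.
    have h1 := ler_wpM2l (ltW n0) (slope c c0).
    have h2 := ler_wpM2l (ltW r_gt0) (ip_le_norm ipP (dx c) h).
    by nra.
  rewrite /g => hg; rewrite -(ler_pM2l n0).
  have : ip (x t) h - ip (x s) h = `|h| ^+ 2 by rewrite -(ipxx ipP) /h !(ipE ipP); ring.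
  by nra.
pose S := [set sqdist z t | t in [set t | 0 < t]].
have infS : has_inf S.
  split; last by exists 0 => _ [t _ <-]; exact: sqr_ge0.
  by exists (sqdist z 1); exists 1; rewrite //= ltr01.
have cx : cvg (x t @[t --> +oo]).
  apply: cauchy_norm_cvg => e e0.
  have re0 : 0 < 2 * r * e by rewrite !mulr_gt0.
  (* Once [sqdist z] is within [2 * r * e] of its infimum, [x_osc] keeps all later positions within
     [e] of [x s]. *)
  have [_ [s s0 <-] hs] := inf_adherent re0 infS.
  exists (x s); near=> t.
  have st : s < t by near: t; apply: nbhs_pinfty_gt; exact: num_real.
  have r2 : 0 < 2 * r by rewrite mulr_gt0.
  rewrite distrC -(ltr_pM2l r2); apply: le_lt_trans (x_osc _ _ s0 st) _.
  have : inf S <= sqdist z t.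
    by apply: ge_inf; [case: infS | exists t => //; exact: lt_trans st].
  by lra.
have [|c [cn dc]] := exists_slow_times; first by exists z.
have coo : c n @[n --> \oo] --> +oo.
  apply/cvgryPge => a; near=> n; apply: le_trans (ltW (cn n)).
  apply: (@le_trans _ _ n%:R); last by rewrite ler_nat.
  by near: n; exact: nbhs_infty_ger.
exists (lim (x t @[t --> +oo])) => //.
apply: (cvg_of_slow_times _ dc _).1 => [n|]; first exact: lt_trans (cn n).
exact: cvg_comp coo cx.
Unshelve. all: by end_near. Qed.

(** Compactness is applied to [y] rather than [x], because the gradient inequality controls [Phi] at
    [y]. *)
Lemma trajectory_cvg_inf_compact (Phi : V -> R) : zeros A !=set0 ->
  convex_fun Phi -> (forall z, differentiable Phi z) ->
  inf_compact Phi -> is_gradient_of ip Phi A ->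
  exists2 l, zeros A l & x t @[t --> +oo] --> l.
Proof.
move=> [z Az] cPhi dPhi icPhi gPhi.
have [|c [cn dc]] := exists_slow_times; first by exists z.
have c0 n : 0 < c n by exact: lt_trans (cn n).
have uc := u_cvg0 c0 dc.
(* Bounds [|y - z|] once the velocity has norm at most 1, and also the excess of [Phi] over [Phi z]
   once [|u| <= 1]. *)
pose rho := `|x 1 - z| + 1.
have rho0 : 0 < rho by rewrite ltr_wpDl.
pose K := [set w : V | `|w| <= rho + `|z| /\ Phi w <= Phi z + rho].
have KP : compact (closure K) by apply: icPhi; rewrite ltr_pwDl.
have yK : \forall n \near \oo, K (y (c n)).
  near=> n.
  have d1 : `|dx (c n)| <= 1 by near: n; exact: cvgr0_norm_le.
  have u1 : `|u (c n)| <= 1 by near: n; exact: cvgr0_norm_le.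
  have xz : `|x (c n) - z| <= `|x 1 - z|.
    by apply: fejer => //; apply: le_trans (ltW (cn n)); rewrite ler1n.
  have yz : `|y (c n) - z| <= rho.
    by rewrite /y addrAC; apply: le_trans (ler_normD _ _) _; exact: lerD.
  split; first by rewrite -[y _](subrK z); apply: le_trans (ler_normD _ _) _; rewrite lerD2r.
  have := gradient_le z cPhi (dPhi _) gPhi (trajectory_graph (c0 n)).
  have : ip (u (c n)) (y (c n) - z) <= rho.
    apply: le_trans (ip_le_norm ipP _ _) _; rewrite -[leRHS]mul1r; exact: ler_pM.
  by rewrite -(opprB z) (ipNr ipP); lra.
have [l [_ lcl]] : closure K `&` cluster (y (c n) @[n --> \oo]) !=set0.
  apply: KP; near=> n; apply: subset_closure; near: n; exact: yK.
(* The indices [k n] need not increase; [n <= k n] suffices for them to tend to infinity. *)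
have /choice[k kP] : forall n, exists k, (n <= k)%N /\ `|l - y (c k)| < n.+1%:R^-1.
  move=> n; have n0 : 0 < n.+1%:R^-1 :> R by rewrite invr_gt0.
  have [||_ [[k /= nk <-] lk]] := lcl [set y (c k) | k in [set k | (n <= k)%N]] (ball l n.+1%:R^-1).
  - by exists n => // k nk; exists k.
  - exact: nbhsx_ballx.
  - by exists k; split => //; move: lk; rewrite -ball_normE.
have koo : k n @[n --> \oo] --> \oo.
  by move=> B [N _ NB]; exists N => // n Nn; apply: NB; exact: leq_trans (kP n).1.
have dck : dx (c (k n)) @[n --> \oo] --> 0 by exact: cvg_comp koo dc.
have yl : y (c (k n)) @[n --> \oo] --> l.
  apply/cvgrPdist_lt => e e0; near=> n; apply: lt_trans (kP n).2 _.
  by near: n; exact: near_infty_natSinv_lt (PosNum e0).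
have [|Al xl] := cvg_of_slow_times (l := l) (fun n => c0 (k n)) dck; last by exists l.
have : y (c (k n)) - dx (c (k n)) @[n --> \oo] --> l - 0 by apply: cvgB.
by rewrite subr0; under eq_fun do rewrite /y addrK.
Unshelve. all: by end_near. Qed.

End Dynamics.

Theorem theorem3p2 (R : realType) (V : completeNormedModType R)
  (ip : V -> V -> R) (A : V -> set V) (theta : R) (p : nat)
  (x : R -> V) (lam : R -> R) :
  is_inner_product ip ->
  maximal_monotone ip A ->
  zeros A !=set0 ->
  0 < theta ->
  (1 <= p)%N ->
  (* (x, lam) is a global solution on [0, +oo) *)
  (forall t, 0 <= t -> 0 < lam t) ->
  {within `[0, +oo[, continuous x} ->
  (forall t, 0 < t -> derivable x t 1) ->
  (forall t, 0 < t -> 'D_1 x t + x t - resolvent A (lam t) (x t) = 0) ->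
  (forall t, 0 <= t ->
     lam t * `|resolvent A (lam t) (x t) - x t| ^+ (p - 1) = theta) ->
  ~ A (x 0) 0 ->
  ((exists Phi : V -> R,
       [/\ convex_fun Phi, (forall y, differentiable Phi y),
           inf_compact Phi & is_gradient_of ip Phi A])
   \/ (zeros A)° !=set0) ->
  exists2 xbar, zeros A xbar & x t @[t --> +oo] --> xbar.
Proof.
move=> ipP maxA zA _ p0 lam0 _ xd xode lamE _ [[Phi [cP dP icP gP]]|intA].
  exact: (trajectory_cvg_inf_compact ipP maxA p0 lam0 xd xode lamE zA cP dP icP gP).
exact: (trajectory_cvg_interior ipP maxA p0 lam0 xd xode lamE intA).
Qed.
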